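(* Let $p\in(1,\infty)$. If $u:\mathbb N_0\to\mathbb R$ satisfies $u(0)=0$ and $u\in\ell^p(\mathbb N,x^{-2})$, then $$\mathcal E_p^{\mathbb N_0}(u)\geq\left(\frac{p-1}{p^2}\right)\sum_{x\in\mathbb N}\frac{|u(x)|^p}{x^2}.$$ Moreover, the constant $(p-1)/p^2$ is sharp, i.e. the inequality (for all such $u$) fails if $(p-1)/p^2$ is replaced by any larger constant.
   Context: $\mathbb N=\{1,2,\ldots\}$, $\mathbb N_0=\{0,1,2,\ldots\}$. For $a\in\mathbb R$ and $\beta>0$, $a^{\langle\beta\rangle}:=|a|^\beta\operatorname{sgn}a$. For $u:\mathbb N_0\to\mathbb R$ with $u(0)=0$, $$\mathcal E_p^{\mathbb N_0}(u):=\sum_{x\in\mathbb N}\bigl(u(x)-u(x-1)\bigr)\bigl(u(x)^{\langle p-1\rangle}-u(x-1)^{\langle p-1\rangle}\bigr)\in[0,\infty].$$ $u\in\ell^p(\mathbb N,x^{-2})$ means $\sum_{x\in\mathbb N}|u(x)|^px^{-2}<\infty$. *)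

(* Defs.v *)
From HB Require Import structures.
From mathcomp Require Import all_boot all_order all_algebra.
From mathcomp Require Import all_classical all_reals all_analysis.
Set Implicit Arguments.
Unset Strict Implicit.
Unset Printing Implicit Defensive.
Import Order.TTheory GRing.Theory Num.Theory.
Local Open Scope ring_scope.

Definition spowR (R : realType) (a b : R) : R := `|a| `^ b * Num.sg a.

(* The summands are nonnegative when 1 < p, so the series below converge in
   [0, +oo] and their values in \bar R are the intended ones. *)
Definition energy (R : realType) (p : R) (u : nat -> R) : \bar R :=
  (\sum_(1 <= x <oo)
     ((u x - u x.-1) * (spowR (u x) (p - 1) - spowR (u x.-1) (p - 1)))%:E)%E.

Definition hardy_sum (R : realType) (p : R) (u : nat -> R) : \bar R :=
  (\sum_(1 <= x <oo) (`|u x| `^ p / x%:R ^+ 2)%:E)%E.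

Definition in_weighted_lp (R : realType) (p : R) (u : nat -> R) : Prop :=
  (hardy_sum p u < +oo)%E.

(* Main.v *)
Require Import Defs.
From HB Require Import structures.
From mathcomp Require Import all_boot all_order all_algebra.
From mathcomp Require Import all_classical all_reals all_analysis.
From mathcomp Require Import ring lra.
Set Implicit Arguments.
Unset Strict Implicit.
Import Order.TTheory GRing.Theory Num.Theory.
Local Open Scope ring_scope.

(** The inequality is the classical case p = 2 in disguise.  The
    Stroock-Varopoulos inequality
      (a - b) (a^<p-1> - b^<p-1>) >= 4 (p-1) / p^2 (|a|^(p/2) - |b|^(p/2))^2
    bounds each summand of the energy of u from below by a multiple of the
    squared increment of v = |u|^(p/2), and the discrete Hardy inequality
      sum (v(x) - v(x-1))^2 >= 1/4 sum v(x)^2 / x^2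
    yields the constant 4 (p-1) / p^2 * 1/4 = (p-1) / p^2.  The two
    inequalities are combined on partial sums in [hardy_partial_sum].

    In the variables y = (p/4) (ln a - ln b) and l = (p-2)/p, the
    Stroock-Varopoulos inequality for positive a, b reads
    sinh(l y)^2 <= l^2 sinh(y)^2 ([sqr_sinh_scale_le]), i.e. it says that
    sinh lies below its chords on the half-line.  The quadratic Hardy
    inequality ([hardy_l2_partial_sum]) is proved by an induction that carries
    the boundary term v(n)^2 / (2 n).

    Sharpness is seen on u(x) = x^((1-e)/p), for which |u(x)|^p / x^2 is
    x^(-1-e).  The weighted norm H is then finite but at least 1/(2e), while
    comparing increments of powers with derivatives gives
    energy <= 1 + (p-1)/p^2 * H ([energy_power_fun_le]).  An inequality with a
    constant C > (p-1)/p^2 would force (C - (p-1)/p^2) H <= 1, which fails for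
    small e. *)

(** * Contraction property of the hyperbolic sine *)

(** The right side minus the left side vanishes at 0 and has the derivative
    2 l (cosh t - cosh (l t)), which is nonnegative because l t <= t. *)
Lemma sinh_scale_le (R : realType) (l y : R) : 0 <= l <= 1 -> 0 <= y ->
  expR (l * y) - expR (- (l * y)) <= l * (expR y - expR (- y)).
Proof.
move=> /andP[l0 l1] y0.
pose g (t : R) := l * (expR t - expR (- t)) - (expR (l * t) - expR (- (l * t))).
have dg (t : R) : is_derive t 1 g
    (l * (expR t + expR (- t) - expR (l * t) - expR (- (l * t)))).
  apply: is_derive_eq.
  rewrite /GRing.scale/=; lra.
suff : g 0 <= g y by rewrite /g mulr0 !oppr0 expR0; lra.
apply: (@ger0_derive1_ndecr R g 0 y) => //.
- move=> t; rewrite in_itv/= => /andP[t0 _].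
  rewrite derive1E (@derive_val _ _ _ _ _ _ _ (dg t)).
  apply: mulr_ge0 => //.
  rewrite !expRN.
  have lt : l * t <= t by rewrite ler_piMl// ltW.
  have B1 : 1 <= expR (l * t) by rewrite -expR0 ler_expR mulr_ge0// ltW.
  have AB : expR (l * t) <= expR t by rewrite ler_expR.
  set A := expR t in AB *; set B := expR (l * t) in B1 AB *.
  have A1 : 1 <= A by lra.
  (* With A >= B >= 1, the function x + 1/x is at least as large at A as at B. *)
  have -> : A + A^-1 - B - B^-1 = (A - B) * (1 - (A * B)^-1).
    by field; apply/andP; split; lra.
  apply: mulr_ge0; first lra.
  rewrite subr_ge0 invf_le1; first by rewrite -[1]mulr1 ler_pM.
  by rewrite mulr_gt0; lra.
- apply: derivable_within_continuous => t _; exact: ex_derive.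
Qed.

(** Squaring removes the sign restrictions on both l and y. *)
Lemma sqr_sinh_scale_le (R : realType) (l y : R) : `|l| <= 1 ->
  (expR (l * y) - expR (- (l * y))) ^+ 2 <= l ^+ 2 * (expR y - expR (- y)) ^+ 2.
Proof.
have even (t : R) : (expR t - expR (- t)) ^+ 2 =
                    (expR `|t| - expR (- `|t|)) ^+ 2.
  by case: (ger0P t) => // _; rewrite opprK -sqrrN opprB.
move=> l1; rewrite even (even y) normrM -(real_normK (num_real l)) -exprMn.
rewrite ler_sqr ?nnegrE.
- by apply: sinh_scale_le => //; rewrite normr_ge0.
- by rewrite subr_ge0 ler_expR; have := mulr_ge0 (normr_ge0 l) (normr_ge0 y); lra.
- by rewrite mulr_ge0// subr_ge0 ler_expR; have := normr_ge0 y; lra.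
Qed.

(** * The Stroock-Varopoulos inequality *)

(** Write m and s for the half-sum and half-difference of ln a and ln b, and
    factor out M^2 = (a b)^(p/2).  With Y = exp(p s / 2), Z = exp((p-2) s / 2),
    the right side is M^2 ((Y - 1/Y)^2 - (Z - 1/Z)^2) and the left side is
    (1 - l^2) M^2 (Y - 1/Y)^2 for l = (p-2)/p, since 4 (p-1)/p^2 = 1 - l^2.
    What remains is the contraction property of sinh. *)
Lemma stroock_varopoulos_gt0 (R : realType) (p a b : R) :
  1 < p -> 0 < a -> 0 < b ->
  4 * (p - 1) / p ^+ 2 * (a `^ (p / 2) - b `^ (p / 2)) ^+ 2 <=
  (a - b) * (a `^ (p - 1) - b `^ (p - 1)).
Proof.
move=> p1 a0 b0.
have p0 : p != 0 by lra.
pose m := (ln a + ln b) / 2; pose s := (ln a - ln b) / 2.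
pose l := (p - 2) / p.
have l1 : `|l| <= 1.
  have p_gt0 : 0 < p by lra.
  by rewrite /l normrM normfV (gtr0_norm p_gt0) ler_pdivrMr// ler_norml; lra.
have := sqr_sinh_scale_le (p / 2 * s) l1.
have lE : l * (p / 2 * s) = (p - 2) / 2 * s by rewrite /l; field.
rewrite lE.
set Y := expR (p / 2 * s); set Z := expR ((p - 2) / 2 * s).
pose M := expR (p / 2 * m).
have ea : expR (ln a) = a by rewrite lnK ?posrE.
have eb : expR (ln b) = b by rewrite lnK ?posrE.
have powE (c q : R) : 0 < c -> c `^ q = expR (q * ln c).
  by move=> c0; rewrite /powR gt_eqF.
have lna : ln a = m + s by rewrite /m /s; field.
have lnb : ln b = m - s by rewrite /m /s; field.
have -> : a `^ (p / 2) = M * Y.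
  by rewrite powE// -expRD lna; congr expR; field.
have -> : b `^ (p / 2) = M * Y^-1.
  by rewrite powE// -expRN -expRD lnb; congr expR; field.
have aa : a * a `^ (p - 1) = M ^+ 2 * Y ^+ 2.
  by rewrite powE// -{1}ea -!expRM_natl -!expRD lna; congr expR; field.
have bb : b * b `^ (p - 1) = M ^+ 2 * Y^-1 ^+ 2.
  by rewrite powE// -{1}eb -expRN -!expRM_natl -!expRD lnb; congr expR; field.
have ab : a * b `^ (p - 1) = M ^+ 2 * Z^-1 ^+ 2.
  by rewrite powE// -{1}ea -expRN -!expRM_natl -!expRD lna lnb; congr expR; field.
have ba : b * a `^ (p - 1) = M ^+ 2 * Z ^+ 2.
  by rewrite powE// -{1}eb -!expRM_natl -!expRD lna lnb; congr expR; field.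
have -> : (a - b) * (a `^ (p - 1) - b `^ (p - 1)) =
    M ^+ 2 * ((Y - Y^-1) ^+ 2 - (Z - Z^-1) ^+ 2).
  rewrite mulrBl !mulrBr aa bb ab ba.
  by field; rewrite !gt_eqF ?expR_gt0.
have -> : 4 * (p - 1) / p ^+ 2 * (M * Y - M * Y^-1) ^+ 2 =
    M ^+ 2 * ((1 - l ^+ 2) * (Y - Y^-1) ^+ 2).
  by rewrite /l; field; rewrite p0 gt_eqF ?expR_gt0.
rewrite !expRN => h; apply: ler_wpM2l; first exact: sqr_ge0.
by rewrite mulrBl mul1r lerB.
Qed.

Lemma stroock_varopoulos_ge0 (R : realType) (p a b : R) :
  1 < p -> 0 <= a -> 0 <= b ->
  4 * (p - 1) / p ^+ 2 * (a `^ (p / 2) - b `^ (p / 2)) ^+ 2 <=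
  (a - b) * (a `^ (p - 1) - b `^ (p - 1)).
Proof.
move=> p1 a0 b0.
(* If one argument is 0, both sides are multiples of the same power c^p, with
   factors 4 (p-1)/p^2 and 1, and p^2 - 4 (p-1) = (p-2)^2. *)
have zero (c : R) : 0 <= c ->
    4 * (p - 1) / p ^+ 2 * (c `^ (p / 2)) ^+ 2 <= c * c `^ (p - 1).
  move=> c0; have [->|cn0] := eqVneq c 0.
    by rewrite mul0r powR0 ?expr0n ?mulr0//; lra.
  have -> : c * c `^ (p - 1) = (c `^ (p / 2)) ^+ 2.
    rewrite -{1}(powRr1 c0) -powRD ?cn0 ?implybT// expr2 -powRD ?cn0 ?implybT//.
    by congr powR; field.
  have p2 : 0 < p ^+ 2 by rewrite exprn_gt0//; lra.
  rewrite ler_piMl ?sqr_ge0// ler_pdivrMr// mul1r.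
  by rewrite -subr_ge0 (_ : _ - _ = (p - 2) ^+ 2) ?sqr_ge0//; ring.
have [a1|a1] := ltrP 0 a; last first.
  have -> : a = 0 by lra.
  rewrite !powR0 ?sub0r ?sqrrN ?mulrNN; [exact: zero|lra|lra].
have [b1|b1] := ltrP 0 b; last first.
  have -> : b = 0 by lra.
  rewrite !powR0 ?subr0; [exact: zero|lra|lra].
exact: stroock_varopoulos_gt0.
Qed.

Lemma spowR_ge0 (R : realType) (a q : R) : 0 < q -> 0 <= a -> spowR a q = a `^ q.
Proof.
move=> q0; rewrite le_eqVlt => /predU1P[<-|a0]; rewrite /spowR.
  by rewrite sgr0 mulr0 powR0//; lra.
by rewrite gtr0_sg// mulr1 gtr0_norm.
Qed.

Lemma spowR_le0 (R : realType) (a q : R) :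
  0 < q -> a <= 0 -> spowR a q = - `|a| `^ q.
Proof.
move=> q0; rewrite le_eqVlt => /predU1P[->|a0]; rewrite /spowR.
  by rewrite sgr0 mulr0 normr0 powR0 ?oppr0//; lra.
by rewrite ltr0_sg// mulrN1.
Qed.

(** Replacing a and b by their absolute values can only decrease the right
    side: for opposite signs it drops by 2 (|a| |b|^(p-1) + |b| |a|^(p-1)). *)
Lemma stroock_varopoulos (R : realType) (p a b : R) : 1 < p ->
  4 * (p - 1) / p ^+ 2 * (`|a| `^ (p / 2) - `|b| `^ (p / 2)) ^+ 2 <=
  (a - b) * (spowR a (p - 1) - spowR b (p - 1)).
Proof.
move=> p1; have q0 : 0 < p - 1 by lra.
apply: le_trans (stroock_varopoulos_ge0 p1 (normr_ge0 a) (normr_ge0 b)) _.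
have A0 := powR_ge0 `|a| (p - 1); have B0 := powR_ge0 `|b| (p - 1).
have [a0|a0] := lerP 0 a; have [b0|b0] := lerP 0 b.
- by rewrite !spowR_ge0// !ger0_norm.
- rewrite spowR_ge0// (spowR_le0 _ (ltW b0))//.
  rewrite (ger0_norm a0) (ltr0_norm b0) in A0 B0 *; nra.
- rewrite (spowR_ge0 _ b0)// (spowR_le0 _ (ltW a0))//.
  rewrite (ger0_norm b0) (ltr0_norm a0) in A0 B0 *; nra.
- rewrite (spowR_le0 _ (ltW a0))// (spowR_le0 _ (ltW b0))// !ltr0_norm//.
  by rewrite le_eqVlt; apply/orP; left; apply/eqP; ring.
Qed.

(** * The quadratic Hardy inequality *)

(** The boundary term makes the induction go through: for N = n + 1,
      (a - b)^2 + b^2 / (2N) >= a^2 / (2N + 1)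
    by completing the square in b, and 1/(2N + 1) exceeds
    1/(4 (N + 1)^2) + 1/(2 (N + 1)).  This is the ground-state argument with
    the ratios 1 + 1/(2x) in place of those of the square-root function. *)
Lemma hardy_l2_partial_sum (R : realFieldType) (v : nat -> R) (n : nat) :
  v 0%N = 0 ->
  4^-1 * (\sum_(1 <= x < n.+2) v x ^+ 2 / x%:R ^+ 2) +
    v n.+1 ^+ 2 / (2 * n.+1%:R) <=
  \sum_(1 <= x < n.+2) (v x - v x.-1) ^+ 2.
Proof.
move=> v0; elim: n => [|n IH].
  by rewrite !big_nat1 v0 subr0 expr1n; have := sqr_ge0 (v 1%N); lra.
rewrite (big_nat_recr n.+2)//= [X in _ <= X](big_nat_recr n.+2)//=.
move: IH; set S := (X in 4^-1 * X + _ <= _); set T := (X in _ <= X -> _).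
set a := v n.+2; set b := v n.+1 => IH.
rewrite -/S -/T -[n.+2%:R]natr1; set N : R := n.+1%:R in IH *.
have N0 : 0 < N by rewrite ltr0n.
suff : 4^-1 * (a ^+ 2 / (N + 1) ^+ 2) + a ^+ 2 / (2 * (N + 1)) <=
       (a - b) ^+ 2 + b ^+ 2 / (2 * N).
  move: IH; set P := _ / (N + 1) ^+ 2; set Q := _ / (2 * (N + 1)).
  by set W := _ / (2 * N); lra.
apply: (@le_trans _ _ (a ^+ 2 / (2 * N + 1))).
  have -> : 4^-1 * (a ^+ 2 / (N + 1) ^+ 2) + a ^+ 2 / (2 * (N + 1)) =
            a ^+ 2 * ((2 * N + 3) / (4 * (N + 1) ^+ 2)).
    by field; lra.
  apply: ler_wpM2l; first exact: sqr_ge0.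
  rewrite ler_pdivrMr; last by rewrite mulr_gt0// exprn_gt0; lra.
  rewrite ler_pdivlMl; last lra.
  nra.
rewrite -subr_ge0.
have -> : (a - b) ^+ 2 + b ^+ 2 / (2 * N) - a ^+ 2 / (2 * N + 1) =
   (2 * N * a - (2 * N + 1) * b) ^+ 2 / (2 * N * (2 * N + 1)).
  by field; apply/andP; split; lra.
by apply: divr_ge0; [exact: sqr_ge0|nra].
Qed.

Lemma hardy_partial_sum (R : realType) (p : R) (u : nat -> R) (n : nat) :
  1 < p -> u 0%N = 0 ->
  (p - 1) / p ^+ 2 * (\sum_(1 <= x < n.+2) `|u x| `^ p / x%:R ^+ 2) <=
  \sum_(1 <= x < n.+2)
     (u x - u x.-1) * (spowR (u x) (p - 1) - spowR (u x.-1) (p - 1)).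
Proof.
move=> p1 u0; pose v x := `|u x| `^ (p / 2).
have v0 : v 0%N = 0 by rewrite /v u0 normr0 powR0//; lra.
have v2 x : v x ^+ 2 = `|u x| `^ p.
  by rewrite /v -powR_mulrn ?powR_ge0// -powRrM; congr powR; field.
have := hardy_l2_partial_sum n v0.
have : 0 <= v n.+1 ^+ 2 / (2 * n.+1%:R).
  by rewrite divr_ge0 ?sqr_ge0// mulr_ge0.
move=> V0 H.
under eq_bigr do rewrite -v2.
have c0 : 0 <= 4 * (p - 1) / p ^+ 2 by rewrite divr_ge0 ?sqr_ge0//; lra.
apply: (@le_trans _ _ (4 * (p - 1) / p ^+ 2 *
    \sum_(1 <= x < n.+2) (v x - v x.-1) ^+ 2)).
  have -> : (p - 1) / p ^+ 2 = 4 * (p - 1) / p ^+ 2 * 4^-1 by field; lra.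
  by rewrite -mulrA ler_wpM2l//; apply: le_trans H; rewrite lerDl.
rewrite mulr_sumr; apply: ler_sum => x _; exact: stroock_varopoulos.
Qed.

(** * Powers, their tangents and their sums *)

(** Convexity of the power with a nonpositive exponent, through
    exp z >= 1 + z and ln (1 + z) <= z. *)
Lemma powRN_tangent (R : realType) (e x y : R) : 0 <= e -> 0 < x -> 0 < y ->
  x `^ (- e) - e * x `^ (- e - 1) * (y - x) <= y `^ (- e).
Proof.
move=> e0 x0 y0.
have -> : x `^ (- e - 1) = x `^ (- e) * x^-1.
  by rewrite powRD ?(gt_eqF x0) ?implybT// powR_inv1// ltW.
have -> : y `^ (- e) = x `^ (- e) * (y / x) `^ (- e).
  by rewrite -powRM ?divr_ge0 ?ltW// mulrCA divff ?mulr1 ?gt_eqF.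
have -> : x `^ (- e) - e * (x `^ (- e) * x^-1) * (y - x) =
          x `^ (- e) * (1 + - e * (y / x - 1)) by field; rewrite gt_eqF.
apply: ler_wpM2l; first exact: powR_ge0.
have yx0 : 0 < y / x by rewrite divr_gt0.
rewrite /powR gt_eqF//; apply: le_trans (expR_ge1Dx _).
rewrite lerD2l; apply: ler_wnM2l; first by rewrite oppr_le0.
rewrite -{1}(subrKC 1 (y / x)); apply: le_ln1Dx; lra.
Qed.

(** Concavity of the power with an exponent in [0, 1]. *)
Lemma powR_tangent (R : realType) (q x y : R) : 0 <= q <= 1 -> 0 < x -> 0 < y ->
  y `^ q <= x `^ q + q * x `^ (q - 1) * (y - x).
Proof.
move=> /andP[q0 q1] x0 y0.
have [->|qn0] := eqVneq q 0; first by rewrite !powRr0; lra.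
have -> : x `^ (q - 1) = x `^ q * x^-1.
  by rewrite powRD ?(gt_eqF x0) ?implybT// powR_inv1// ltW.
have -> : y `^ q = x `^ q * (y / x) `^ q.
  by rewrite -powRM ?divr_ge0 ?ltW// mulrCA divff ?mulr1 ?gt_eqF.
have -> : x `^ q + q * (x `^ q * x^-1) * (y - x) =
          x `^ q * (1 + q * (y / x - 1)) by field; rewrite gt_eqF.
apply: ler_wpM2l; first exact: powR_ge0.
have : 0 < y / x by rewrite divr_gt0.
set t := y / x => t0.
have B0 : 0 < 1 + q * (t - 1) by nra.
rewrite /powR gt_eqF// -[leRHS](@lnK _ (1 + q * (t - 1))) ?posrE// ler_expR.
set B := 1 + _ in B0 *.
(* Concavity of ln at B, with both t and 1 measured against B. *)
have ln_le (z : R) : 0 < z -> ln z <= ln B + (z / B - 1).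
  move=> z0; have zB : 0 < z / B by rewrite divr_gt0.
  rewrite -{1}(divfK (lt0r_neq0 B0) z) lnM ?posrE// addrC lerD2l.
  by rewrite -{1}(subrKC 1 (z / B)); apply: le_ln1Dx; lra.
have h1 := ler_wpM2l q0 (ln_le t t0).
have h2 := ler_wpM2l (_ : 0 <= 1 - q) (ln_le 1 ltr01).
rewrite ln1 in h2; have {}h2 := h2 ltac:(lra).
have : q * (t / B - 1) + (1 - q) * (1 / B - 1) = 0.
  by rewrite /B; field; rewrite -/B gt_eqF.
lra.
Qed.

(** The tangent of t^(-e) at x gives the telescoping bound
    e x^(-e-1) <= (x-1)^(-e) - x^(-e), for x >= 2. *)
Lemma sum_powR_le (R : realType) (e : R) (n : nat) : 0 < e ->
  \sum_(1 <= x < n.+2) x%:R `^ (- e - 1) <= 1 + e^-1 - e^-1 * n.+1%:R `^ (- e).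
Proof.
move=> e0; elim: n => [|n IH]; first by rewrite big_nat1 !powR1; lra.
rewrite (big_nat_recr n.+2)//=.
have := @powRN_tangent R e n.+2%:R n.+1%:R (ltW e0) (ltr0Sn _ _) (ltr0Sn _ _).
have -> : n.+1%:R - n.+2%:R = - 1 :> R by rewrite -[n.+2%:R]natr1; ring.
set A := n.+2%:R `^ (- e); set D := n.+2%:R `^ (- e - 1).
set F := n.+1%:R `^ _ in IH * => h.
have : e^-1 * (A + e * D) <= e^-1 * F.
  by apply: ler_wpM2l; rewrite ?invr_ge0; lra.
rewrite mulrDr mulKf ?gt_eqF//; lra.
Qed.

(** The same tangent, now compared with the value at x + 1, telescopes in the
    other direction. *)
Lemma sum_powR_ge (R : realType) (e : R) (n : nat) : 0 < e ->
  e^-1 * (1 - n.+1%:R `^ (- e)) <= \sum_(1 <= x < n.+1) x%:R `^ (- e - 1).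
Proof.
move=> e0; elim: n => [|n IH].
  by rewrite big_geq// powR1 subrr mulr0.
rewrite (big_nat_recr n.+1)//=.
have := @powRN_tangent R e n.+1%:R n.+2%:R (ltW e0) (ltr0Sn _ _) (ltr0Sn _ _).
have -> : n.+2%:R - n.+1%:R = 1 :> R by rewrite -[n.+2%:R]natr1; ring.
set A := n.+1%:R `^ (- e); set D := n.+1%:R `^ (- e - 1) in IH *.
set F := n.+2%:R `^ _  => h.
have : e^-1 * (A - e * D) <= e^-1 * F.
  by apply: ler_wpM2l; rewrite ?invr_ge0; lra.
rewrite mulrBr mulKf ?gt_eqF//; rewrite -/A in IH; lra.
Qed.

Lemma powR_increments_le (R : realType) (a b x : R) :
  0 <= a <= 1 -> 0 <= b <= 1 -> 0 < x ->
  ((x + 1) `^ a - x `^ a) * ((x + 1) `^ b - x `^ b) <=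
  a * b * x `^ (a + b - 2).
Proof.
move=> a01 b01 x0; have x10 : 0 < x + 1 by lra.
have le (q : R) : 0 <= q <= 1 ->
    0 <= (x + 1) `^ q - x `^ q <= q * x `^ (q - 1).
  move=> q01; have := powR_tangent q01 x0 x10.
  have -> : x + 1 - x = 1 by ring.
  have : x `^ q <= (x + 1) `^ q.
    by apply: ge0_ler_powR; rewrite ?nnegrE; lra.
  lra.
have /andP[A0 A1] := le a a01; have /andP[B0 B1] := le b b01.
have -> : a * b * x `^ (a + b - 2) = a * x `^ (a - 1) * (b * x `^ (b - 1)).
  rewrite mulrACA -powRD; last by rewrite (gt_eqF x0) implybT.
  by congr (_ * powR _ _); ring.
exact: ler_pM.
Qed.

(** * Series of nonnegative reals and their partial sums *)

Lemma partial_sum_le_series (R : realType) (f : nat -> R) (n : nat) :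
  (forall m, (1 <= m)%N -> 0 <= f m) ->
  ((\sum_(1 <= x < n) f x)%:E <= \sum_(1 <= x <oo) (f x)%:E)%E.
Proof.
move=> f_ge0; rewrite -sumEFin; apply: nneseries_lim_ge => m m1 _.
by rewrite lee_fin f_ge0.
Qed.

Lemma series_le (R : realType) (f : nat -> R) (M : \bar R) :
  (forall m, (1 <= m)%N -> 0 <= f m) ->
  (forall n, ((\sum_(1 <= x < n.+2) f x)%:E <= M)%E) ->
  (\sum_(1 <= x <oo) (f x)%:E <= M)%E.
Proof.
move=> f_ge0 fM; apply: lime_le.
  by apply: is_cvg_nneseries => m m1 _; rewrite lee_fin f_ge0.
(* The range 1 <= x < n is nonempty from n = 2 on. *)
by exists 2%N => // -[|[|n]]//= _; rewrite sumEFin.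
Qed.

Lemma energy_term_ge0 (R : realType) (p : R) (u : nat -> R) (x : nat) : 1 < p ->
  0 <= (u x - u x.-1) * (spowR (u x) (p - 1) - spowR (u x.-1) (p - 1)).
Proof.
move=> p1; apply: le_trans (stroock_varopoulos _ _ p1).
by rewrite mulr_ge0 ?sqr_ge0// divr_ge0 ?sqr_ge0//; lra.
Qed.

Lemma hardy_term_ge0 (R : realType) (p : R) (u : nat -> R) (x : nat) :
  0 <= `|u x| `^ p / x%:R ^+ 2.
Proof. by rewrite divr_ge0 ?powR_ge0 ?exprn_ge0. Qed.

(** * Almost-extremal power functions *)

(** Its p-th power is x^(1-e), which fails to be summable against x^(-2)
    exactly when e reaches 0. *)
Definition power_fun (R : realType) (p e : R) (x : nat) : R :=
  x%:R `^ ((1 - e) / p).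

Lemma power_fun0 (R : realType) (p e : R) : 1 < p -> e < 1 ->
  power_fun p e 0 = 0.
Proof.
move=> p1 e1; by rewrite /power_fun powR0// mulf_neq0 ?invr_neq0//; lra.
Qed.

Lemma hardy_term_power_fun (R : realType) (p e : R) (x : nat) :
  1 < p -> (1 <= x)%N ->
  `|power_fun p e x| `^ p / x%:R ^+ 2 = x%:R `^ (- e - 1).
Proof.
move=> p1 x1; have x0 : 0 < x%:R :> R by rewrite ltr0n.
rewrite ger0_norm ?powR_ge0// -powRrM -powR_mulrn ?ltW// -powRN.
rewrite -powRD; last by rewrite (gt_eqF x0) implybT.
by congr powR; field; lra.
Qed.

(** With a = (1-e)/p, both u and its (p-1)-st power are powers with exponents
    a and a (p-1) in [0, 1]; the product of these is (1-e)^2 (p-1)/p^2, at most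
    the Hardy constant. *)
Lemma energy_term_power_fun (R : realType) (p e : R) (n : nat) :
  1 < p -> 0 < e < 1 ->
  (power_fun p e n.+2 - power_fun p e n.+1) *
  (spowR (power_fun p e n.+2) (p - 1) - spowR (power_fun p e n.+1) (p - 1)) <=
  (p - 1) / p ^+ 2 * n.+1%:R `^ (- e - 1).
Proof.
move=> p1 /andP[e0 e1]; pose a := (1 - e) / p.
have a01 : 0 <= a <= 1.
  by rewrite /a; apply/andP; split; [apply: divr_ge0|rewrite ler_pdivrMr]; lra.
have b01 : 0 <= a * (p - 1) <= 1.
  apply/andP; split; first by apply: mulr_ge0; [case/andP: a01|lra].
  by rewrite /a mulrAC ler_pdivrMr; nra.
rewrite !spowR_ge0 ?powR_ge0 ?subr_gt0// /power_fun -!powRrM -/a.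
have x0 : 0 < n.+1%:R :> R by rewrite ltr0n.
have := powR_increments_le a01 b01 x0.
rewrite natr1 => /le_trans; apply.
have -> : a + a * (p - 1) - 2 = - e - 1 by rewrite /a; field; lra.
apply: ler_wpM2r; first exact: powR_ge0.
have -> : a * (a * (p - 1)) = (1 - e) ^+ 2 * ((p - 1) / p ^+ 2).
  by rewrite /a; field; lra.
apply: ler_piMl; first by rewrite divr_ge0 ?sqr_ge0//; lra.
nra.
Qed.

(** The increment from 0 to 1 contributes exactly 1; every later increment is
    charged to the Hardy summand at its left endpoint. *)
Lemma energy_power_fun_partial (R : realType) (p e : R) (n : nat) :
  1 < p -> 0 < e < 1 ->
  \sum_(1 <= x < n.+2) (power_fun p e x - power_fun p e x.-1) *
     (spowR (power_fun p e x) (p - 1) - spowR (power_fun p e x.-1) (p - 1)) <=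
  1 + (p - 1) / p ^+ 2 * \sum_(1 <= x < n.+1) x%:R `^ (- e - 1).
Proof.
move=> p1 e01; have /andP[e0 e1] := e01.
elim: n => [|n IH].
  rewrite big_nat1/= (power_fun0 p1 e1) !spowR_ge0 ?powR_ge0 ?subr_gt0//.
  rewrite /power_fun !powR1 powR0 ?subr_eq0 ?gt_eqF// big_geq//; lra.
rewrite (big_nat_recr n.+2)//= [X in _ <= _ + _ * X](big_nat_recr n.+1)//=.
rewrite [X in _ <= 1 + X]mulrDr addrA; apply: lerD => //.
exact: energy_term_power_fun.
Qed.

Lemma hardy_sum_power_fun_le (R : realType) (p e : R) : 1 < p -> 0 < e ->
  (hardy_sum p (power_fun p e) <= (1 + e^-1)%:E)%E.
Proof.
move=> p1 e_gt0; apply: series_le => [n _|n]; first exact: hardy_term_ge0.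
rewrite lee_fin (eq_big_nat _ _ (F2 := fun x => x%:R `^ (- e - 1))).
  apply: le_trans (sum_powR_le n e_gt0) _.
  by rewrite gerBl mulr_ge0 ?powR_ge0// invr_ge0 ltW.
by move=> x /andP[x1 _]; exact: hardy_term_power_fun.
Qed.

Lemma hardy_sum_power_fun_ge (R : realType) (p e : R) : 1 < p -> 0 < e ->
  ((2 * e)^-1%:E <= hardy_sum p (power_fun p e))%E.
Proof.
move=> p1 e_gt0.
(* Once (N + 1)^e >= 2, the first N summands add up to at least 1/(2e). *)
pose N := Num.trunc (2 `^ e^-1 : R).
have N2 : 2 <= N.+1%:R `^ e.
  have two : 2 = (2 `^ e^-1) `^ e :> R by rewrite -powRrM mulVf ?powRr1 ?gt_eqF.
  rewrite [leLHS]two.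
  apply: ge0_ler_powR; rewrite ?nnegrE ?powR_ge0//; first exact: ltW.
  exact/ltW/truncnS_gt.
have h_ge0 x (_ : (1 <= x)%N) := hardy_term_ge0 p (power_fun p e) x.
apply: le_trans (partial_sum_le_series N.+1 h_ge0).
rewrite lee_fin (eq_big_nat _ _ (F2 := fun x => x%:R `^ (- e - 1))).
  apply: le_trans (sum_powR_ge N e_gt0).
  rewrite invfM mulrC; apply: ler_wpM2l; first by rewrite invr_ge0 ltW.
  rewrite powRN; have : (N.+1%:R `^ e)^-1 <= 2^-1 by rewrite lef_pV2// posrE; lra.
  lra.
by move=> x /andP[x1 _]; exact: hardy_term_power_fun.
Qed.

Lemma energy_power_fun_le (R : realType) (p e : R) :
  1 < p -> 0 < e < 1 ->
  (energy p (power_fun p e) <=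
   1%:E + ((p - 1) / p ^+ 2)%:E * hardy_sum p (power_fun p e))%E.
Proof.
move=> p1 e01; apply: series_le => [n _|n]; first exact: energy_term_ge0.
have c0 : 0 <= (p - 1) / p ^+ 2 by rewrite divr_ge0 ?sqr_ge0//; lra.
apply: (@le_trans _ _
  (1 + (p - 1) / p ^+ 2 * \sum_(1 <= x < n.+1) x%:R `^ (- e - 1))%:E).
  by rewrite lee_fin energy_power_fun_partial.
rewrite EFinD EFinM leeD2l// lee_wpmul2l ?lee_fin//.
have h_ge0 x (_ : (1 <= x)%N) := hardy_term_ge0 p (power_fun p e) x.
apply: le_trans (partial_sum_le_series n.+1 h_ge0).
rewrite lee_fin le_eqVlt; apply/orP; left; apply/eqP/eq_big_nat => x /andP[x1 _].
by rewrite hardy_term_power_fun.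
Qed.

(** * The Hardy inequality and its sharpness *)

Theorem theorem1p4 (R : realType) (p : R) (hp : 1 < p) :
  (forall u : nat -> R, u 0%N = 0 -> in_weighted_lp p u ->
     (((p - 1) / p ^+ 2)%:E * hardy_sum p u <= energy p u)%E) /\
  (forall C : R, (p - 1) / p ^+ 2 < C ->
     ~ (forall u : nat -> R, u 0%N = 0 -> in_weighted_lp p u ->
          (C%:E * hardy_sum p u <= energy p u)%E)).
Proof.
have c0 : 0 <= (p - 1) / p ^+ 2 by rewrite divr_ge0 ?sqr_ge0//; lra.
split=> [u u0 _|C cC hC].
  rewrite /hardy_sum -nneseriesZl; last first.
    by move=> x _; rewrite lee_fin hardy_term_ge0.
  under eq_eseriesr do rewrite -EFinM.
  apply: series_le => [x _|n]; first by rewrite mulr_ge0// hardy_term_ge0.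
  have e_ge0 x (_ : (1 <= x)%N) := energy_term_ge0 u x hp.
  apply: le_trans (partial_sum_le_series n.+2 e_ge0).
  by rewrite lee_fin -mulr_sumr hardy_partial_sum.
set c := (p - 1) / p ^+ 2 in c0 cC.
(* The second bound makes (C - c) / (2 e), and hence (C - c) H, at least 2. *)
pose e := Num.min (2^-1) ((C - c) / 4).
have e0 : 0 < e by rewrite lt_min; apply/andP; split; lra.
have e1 : e <= 2^-1 by rewrite ge_min lexx.
have e2 : e <= (C - c) / 4 by rewrite ge_min lexx orbT.
have e_lt1 : e < 1 by lra.
have H_le := hardy_sum_power_fun_le hp e0.
have H_ge := hardy_sum_power_fun_ge hp e0.
have Hlt : (hardy_sum p (power_fun p e) < +oo)%E by apply: le_lt_trans H_le (ltry _).
have e01 : 0 < e < 1 by rewrite e0.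
have E_le := energy_power_fun_le hp e01.
have := le_trans (hC _ (power_fun0 hp e_lt1) Hlt) E_le.
have Hfin : hardy_sum p (power_fun p e) \is a fin_num.
  by rewrite fin_numE (lt_eqF Hlt) andbT; apply: contraTneq H_ge => ->.
rewrite -(fineK Hfin) lee_fin in H_ge *.
set H := fine _ in H_ge *; rewrite -/c -!EFinM -EFinD lee_fin.
have : (C - c) * (2 * e)^-1 <= (C - c) * H by apply: ler_wpM2l => //; lra.
have : 2 <= (C - c) * (2 * e)^-1 by rewrite ler_pdivlMr; lra.
lra.
Qed.
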